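(* Let $\gamma$ be a probability level and let $\nu_V^*=\min_{(x,T(x))\in\mathcal X_T}\mathrm{VaR}_\gamma\mathbb T(x)$. Then $$\nu_V^*\le\min_{(x,T(x))\in\mathcal X_T}\mathbb E_{\gamma-\widetilde\gamma}[\mathbb T(x)]$$ for every probability level $\widetilde\gamma$ with $\gamma<\widetilde\gamma$ and $\widetilde\gamma=\gamma+\delta$ for some $\delta\ge0$.
   Context: Let $\mathcal X\subseteq\mathbb R^k$ be nonempty and let $Y$ be a discrete random vector in $\mathbb R^m$ having $n$ distinct realizations (atoms) $y_1,\dots,y_n$ with probabilities $p_1,\dots,p_n$ ($p_i>0$, $\sum_ip_i=1$). Let $f:\mathcal X\times\mathbb R^m\to\mathbb R$ be such that for each fixed realization $y$ of $Y$, $f(x,y)$ is linear in $x$. For $x\in\mathcal X$ put $\mathbb T(x)=f(x,Y)$, $T_i(x)=f(x,y_i)$, $T(x)=(T_1(x),\dots,T_n(x))$; $\mathbb T(x)$ takes the values $T_i(x)$ with associated probabilities $p_i$. Let $F(t)=\mathbb P(\mathbb T(x)\le t)$ and $F^{-1}(p)=\inf\{t:F(t)\ge p\}$. Probability levels are numbers in $[0,1]$. The constraints $x\in\mathcal X$ and $T_i(x)=f(x,y_i)$, $i=1,\dots,n$, are represented as $Ax+BT(x)\le c$ with $A\in\mathbb R^{l\times k}$, $B\in\mathbb R^{l\times n}$, $c\in\mathbb R^l$, and $\mathcal X_T=\{(x,T(x)):Ax+BT(x)\le c\}$ is assumed nonempty, closed and convex. Here $\min$ of an optimization problem denotes its optimal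 value. $\mathrm{VaR}_p\mathbb T(x)=\inf\{\eta\in\mathbb R:\mathbb P(\mathbb T(x)\le\eta)\ge p\}=F^{-1}(p)$. For $0\le\alpha<1$, $\mathbb E_{\alpha-1}[\mathbb T(x)]=\frac1{1-\alpha}\max\{\sum_iT_i(x)w_ip_i:w\in[0,1]^n,\sum_iw_ip_i=1-\alpha\}$. For $0\le\alpha<\gamma\le1$, $\mathbb E_{\alpha-\gamma}[\mathbb T(x)]=\frac1{\gamma-\alpha}\big((1-\alpha)\mathbb E_{\alpha-1}[\mathbb T(x)]-(1-\gamma)\mathbb E_{\gamma-1}[\mathbb T(x)]\big)$ (last term $0$ if $\gamma=1$); equivalently $\frac1{\gamma-\alpha}\int_\alpha^\gamma F^{-1}(p)\,dp$. *)

(* Defs.v *)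
From HB Require Import structures.
From mathcomp Require Import all_boot all_order all_algebra.
From mathcomp Require Import all_classical all_reals all_analysis.

Set Implicit Arguments.
Unset Strict Implicit.
Unset Printing Implicit Defensive.

Import Order.TTheory GRing.Theory Num.Theory.
Import numFieldNormedType.Exports.

Local Open Scope classical_set_scope.
Local Open Scope ring_scope.

(* Vectors of R^q are column vectors 'cV[R]_q. The library has no sigma-algebra
   on 'cV[R]_m, so measurability of a random vector is stated coordinatewise.
   The atoms are exactly the values of Y: Y takes no other value, even on a
   null set, so every f x \o Y is a simple function. *)
Definition discrete_random_vector (R : realType) (d : measure_display)
    (Omega : measurableType d) (P : probability Omega R) (m n : nat)
    (Y : Omega -> 'cV[R]_m) (y : 'I_n -> 'cV[R]_m) (p : 'I_n -> R) : Prop :=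
  [/\ forall j, measurable_fun [set: Omega] (fun w => Y w j 0),
      injective y,
      forall w, exists i, Y w = y i,
      forall i, P [set w | Y w = y i] = (p i)%:E /\ 0 < p i
    & \sum_(i < n) p i = 1].

(* Linearity on a subset X of R^k that need not be a subspace: g is the
   restriction to X of a linear form. *)
Definition linear_on (R : realType) (k : nat) (X : set 'cV[R]_k)
    (g : 'cV[R]_k -> R) : Prop :=
  exists h : {scalar 'cV[R]_k}, forall x, X x -> g x = h x.

Definition scenarios (R : realType) (k m n : nat)
    (f : 'cV[R]_k -> 'cV[R]_m -> R) (y : 'I_n -> 'cV[R]_m) (x : 'cV[R]_k) :
    'cV[R]_n :=
  \col_(i < n) f x (y i).

Definition lin_constr (R : realType) (k n l : nat) (A : 'M[R]_(l, k))
    (B : 'M[R]_(l, n)) (c : 'cV[R]_l) (x : 'cV[R]_k) (t : 'cV[R]_n) : Prop :=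
  forall i, (A *m x + B *m t) i 0 <= c i 0.

Definition feasible (R : realType) (k m n l : nat)
    (f : 'cV[R]_k -> 'cV[R]_m -> R) (y : 'I_n -> 'cV[R]_m)
    (A : 'M[R]_(l, k)) (B : 'M[R]_(l, n)) (c : 'cV[R]_l) :
    set ('cV[R]_k * 'cV[R]_n) :=
  [set z | z.2 = scenarios f y z.1 /\ lin_constr A B c z.1 z.2].

(* Extended real: the value is -oo at level 0, where the infimum is over all
   of R. *)
Definition VaR (R : realType) (d : measure_display)
    (Omega : measurableType d) (P : probability Omega R) (Z : Omega -> R)
    (q : R) : \bar R :=
  ereal_inf [set eta%:E | eta in
               [set eta : R | (q%:E <= P [set w | (Z w <= eta)%R])%E]].

(* E_(alpha - 1), for 0 <= alpha < 1; the set below is then nonempty and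
   compact, so that sup is its maximum. *)
Definition upper_mean (R : realType) (n : nat) (p : 'I_n -> R)
    (t : 'cV[R]_n) (alpha : R) : R :=
  (1 - alpha)^-1 *
  sup [set \sum_(i < n) t i 0 * w i * p i | w in
         [set w : 'I_n -> R | (forall i, 0 <= w i <= 1) /\
                              \sum_(i < n) w i * p i = 1 - alpha]].

(* E_(alpha - gamma), for 0 <= alpha < gamma <= 1. *)
Definition partial_mean (R : realType) (n : nat) (p : 'I_n -> R)
    (t : 'cV[R]_n) (alpha gamma : R) : R :=
  (gamma - alpha)^-1 *
  ((1 - alpha) * upper_mean p t alpha
   - (if gamma == 1 then 0 else (1 - gamma) * upper_mean p t gamma)).

(* Optimal value of the minimization of g over S; it may be -oo, and the
   minimum need not be attained. *)
Definition min_value (R : realType) (U : Type) (S : set U) (g : U -> \bar R) :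
    \bar R :=
  ereal_inf [set g u | u in S].

(* Main.v *)
Require Import Defs.
From HB Require Import structures.
From mathcomp Require Import all_boot all_order all_algebra.
From mathcomp Require Import all_classical all_reals all_analysis.
From mathcomp Require Import ring lra.

Import Order.TTheory GRing.Theory Num.Theory.
Import numFieldNormedType.Exports.

Local Open Scope classical_set_scope.
Local Open Scope ring_scope.

(** It suffices to compare the two objectives at each feasible point: if the
    random variable T takes the values t_i with probabilities p_i, then
    VaR_gamma T <= E_(gamma - gamma')[T]. In terms of quantiles this is clear,
    the right-hand side being the average over the levels gamma < q < gamma' of
    the nondecreasing function F^-1. Here, however, the partial mean is given
    as a difference of two optimal values U(gamma) - U(gamma') of knapsack
    problems, divided by gamma' - gamma, and the proof argues directly on these.

    [le_partial_mean] is the core: when T >= b with probability at least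
    1 - gamma, any weights of total mass 1 - gamma' can be completed to total
    mass 1 - gamma by adding mass on {T >= b} only. Every unit of added mass
    contributes at least b to the objective, so
    U(gamma) >= U(gamma') + (gamma' - gamma) b.

    [le_mass_partial_mean] deduces P(T <= e) >= gamma for the partial mean e.
    Otherwise T > e has probability more than 1 - gamma, and because T has
    finitely many values, T > e is the event T >= b, where b > e is the
    smallest value above e; the core lemma then gives b <= e. Hence e is one of
    the numbers whose infimum is VaR_gamma T. *)

Section TailSums.
Variables (R : realType) (n : nat) (p : 'I_n -> R) (t : 'cV[R]_n).
Hypotheses (p_gt0 : forall i, 0 < p i) (p_sum1 : \sum_(i < n) p i = 1).

Definition tail_weights (a : R) : set ('I_n -> R) :=
  [set w | (forall i, 0 <= w i <= 1) /\ \sum_(i < n) w i * p i = 1 - a].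

Definition tail_sums (a : R) : set R :=
  [set \sum_(i < n) t i 0 * w i * p i | w in tail_weights a].

Lemma tail_weights_cst (a : R) : 0 <= a <= 1 -> tail_weights a (fun=> 1 - a).
Proof.
move=> a01; split=> [_|]; first by lra.
by rewrite -mulr_sumr p_sum1 mulr1.
Qed.

Lemma tail_sums_neq0 (a : R) : 0 <= a <= 1 -> tail_sums a !=set0.
Proof.
by move=> /tail_weights_cst wa; exists (\sum_(i < n) t i 0 * (1 - a) * p i),
  (fun=> 1 - a).
Qed.

Lemma tail_sums_has_ubound (a : R) : has_ubound (tail_sums a).
Proof.
exists (\sum_(i < n) `|t i 0| * p i) => _ [w [w01 _] <-].
apply: ler_sum => i _; apply: ler_wpM2r; first exact: ltW.
apply: le_trans (ler_norm _) _; rewrite normrM.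
by have /andP[w_ge0 w_le1] := w01 i; rewrite (ger0_norm w_ge0) ler_piMr.
Qed.

Lemma tail_sums1 : tail_sums 1 = [set 0].
Proof.
have wp0 w : tail_weights 1 w -> \sum_(i < n) t i 0 * w i * p i = 0.
  move=> [w01 wp]; apply: big1 => i _; rewrite -mulrA.
  rewrite subrr in wp; have -> : w i * p i = 0; last by rewrite mulr0.
  apply: (psumr_eq0P _ wp) => // j _.
  by have /andP[wj _] := w01 j; rewrite mulr_ge0// ltW.
apply/seteqP; split=> [_ [w /wp0 + <-]//|_ ->].
have w0 : tail_weights 1 (fun=> 1 - 1) by apply: tail_weights_cst; lra.
by exists (fun=> 1 - 1) => //; exact: wp0.
Qed.

(** The convention that the second term is 0 at level 1 agrees with the general
    formula, because weights of total mass 0 only yield the sum 0; the case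
    g = 1 therefore needs no separate treatment below. *)
Lemma partial_meanE (a g : R) : a < g <= 1 ->
  partial_mean p t a g = (g - a)^-1 * (sup (tail_sums a) - sup (tail_sums g)).
Proof.
move=> /andP[ag g1]; rewrite /partial_mean /upper_mean.
rewrite mulVKf; last by apply/eqP; lra.
congr (_ * (_ - _)); case: eqP => [->|/eqP g_neq1].
  by rewrite tail_sums1 sup1.
by rewrite mulVKf// subr_eq0 eq_sym.
Qed.

(** Filling: weights w of mass 1 - g leave enough room on the event t >= b to be
    raised there to mass 1 - a, since that event has mass at least 1 - a. The
    inequality U(a) >= U(g) + (g - a) b follows from this for arbitrary w, so
    that optimal weights need not be described. *)
Lemma le_partial_mean (a g b : R) : 0 <= a < g -> g <= 1 ->
  1 - a <= \sum_(i < n | b <= t i 0) p i -> b <= partial_mean p t a g.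
Proof.
move=> /andP[a_ge0 ag] g_le1 mass_b.
rewrite partial_meanE ?ag// ler_pdivlMl ?subr_gt0// lerBrDr addrC.
rewrite -lerBrDr.
apply: ge_sup; first by apply: tail_sums_neq0; lra.
move=> _ [w [w01 wp] <-]; rewrite lerBrDr.
pose room := \sum_(i < n | b <= t i 0) (1 - w i) * p i.
have ga_room : g - a <= room.
  have : \sum_(i < n | b <= t i 0) w i * p i <= 1 - g.
    rewrite -wp [leRHS](bigID (fun i => b <= t i 0))/= lerDl.
    by apply: sumr_ge0 => i _; have /andP[wi _] := w01 i; rewrite mulr_ge0// ltW.
  have -> : room = \sum_(i < n | b <= t i 0) p i
                  - \sum_(i < n | b <= t i 0) w i * p i.
    by rewrite -sumrB; apply: eq_bigr => i _; rewrite mulrBl mul1r.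
  lra.
have room_gt0 : 0 < room by lra.
(* The same fraction of the remaining room is filled at every atom of the event;
   the fraction makes the added mass equal to g - a. *)
pose u i := if b <= t i 0 then (g - a) / room * (1 - w i) else 0.
have u_ratio : 0 <= (g - a) / room <= 1.
  rewrite ler_pdivrMr// mul1r ga_room andbT divr_ge0//; first by lra.
  exact: ltW.
have u_sum : \sum_(i < n) u i * p i = g - a.
  rewrite /u; under eq_bigr do rewrite (fun_if (fun z => z * p _)) mul0r -mulrA.
  by rewrite -big_mkcond -mulr_sumr divfK// gt_eqF.
have wu : tail_weights a (fun i => w i + u i).
  split=> [i|].
    have wi := w01 i; rewrite /u; case: ifP => _; last by rewrite addr0.
    by nra.
  by under eq_bigr do rewrite mulrDl; rewrite big_split/= wp u_sum; lra.
apply: le_trans (ub_le_sup (tail_sums_has_ubound a) _); last first.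
  by exists (fun i => w i + u i).
under [leRHS]eq_bigr do rewrite mulrDr mulrDl.
rewrite big_split/= lerD2l mulrC -u_sum mulr_sumr.
apply: ler_sum => i _; rewrite mulrA; apply: ler_wpM2r; first exact: ltW.
rewrite /u; case: ifPn => [bt|_]; last by rewrite !mulr0.
have /andP[_ wi1] := w01 i; have /andP[r0 _] := u_ratio.
by rewrite ler_wpM2r// mulr_ge0// subr_ge0.
Qed.

(** Finiteness of the set of values is what turns a strict excess over the partial
    mean e into a bound b > e to which the filling lemma applies. *)
Lemma le_mass_partial_mean (a g : R) : 0 <= a < g -> g <= 1 ->
  a <= \sum_(i < n | t i 0 <= partial_mean p t a g) p i.
Proof.
move=> ag g_le1; rewrite leNgt; apply/negP => mass_lt.
set e := partial_mean p t a g in mass_lt.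
have mass_gt : 1 - a < \sum_(i < n | e < t i 0) p i.
  move: p_sum1; rewrite (bigID (fun i => t i 0 <= e))/=.
  by under [X in _ + X = _]eq_bigl do rewrite -ltNge; lra.
have [i0 ei0|no_i] := pickP (fun i => e < t i 0); last first.
  by move: mass_gt; rewrite big_pred0//; lra.
have [i ei i_min] :=
  @arg_minP _ R _ i0 (fun i => e < t i 0) (fun i => t i 0) ei0.
suff : t i 0 <= e by rewrite leNgt ei.
apply: le_partial_mean => //; apply: ltW; apply: lt_le_trans mass_gt _.
rewrite le_eqVlt; apply/orP; left; apply/eqP; apply: eq_bigl => j.
by apply/idP/idP => [/i_min//|]; exact: lt_le_trans.
Qed.

End TailSums.

Section DiscreteVaR.
Variables (R : realType) (d : measure_display) (Omega : measurableType d).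
Variables (P : probability Omega R) (m n : nat).
Variables (Y : Omega -> 'cV[R]_m) (y : 'I_n -> 'cV[R]_m) (p : 'I_n -> R).
Hypothesis HY : discrete_random_vector P Y y p.

(** Only the coordinates of Y are known to be measurable, so an atom is written
    as a finite intersection of preimages of points. *)
Lemma measurable_atom (i : 'I_n) : measurable [set w | Y w = y i].
Proof.
have [mY _ _ _ _] := HY.
have -> : [set w | Y w = y i] =
    \bigcap_(j in [set: 'I_m]) [set w | Y w j 0 = y i j 0].
  apply/seteqP; split=> [w /= Yw j _|w Yw] /=; first by rewrite Yw.
  by apply/matrixP => j j'; rewrite (ord1 j') Yw.
apply: fin_bigcap_measurable => // j _.
by have := mY j measurableT _ (measurable_set1 (y i j 0)); rewrite setTI.
Qed.

Lemma probability_atoms (Q : pred 'cV[R]_m) :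
  P [set w | Q (Y w)] = (\sum_(i < n | Q (y i)) p i)%:E.
Proof.
have [_ y_inj Y_atom Pp _] := HY.
have -> : [set w | Q (Y w)] =
    \big[setU/set0]_(i < n | Q (y i)) [set w | Y w = y i].
  rewrite -bigcup_pred; apply/seteqP; split=> [w /= QYw|w [i /= Qi ->]//].
  by have [i Yi] := Y_atom w; exists i => //=; rewrite unfold_in -Yi.
rewrite measure_bigsetU_ord.
- rewrite -sumEFin; apply: eq_bigr => i _; exact: (proj1 (Pp i)).
- exact: measurable_atom.
- by move=> i j _ _ [w [/= -> /y_inj]].
Qed.

(** The partial mean is itself an admissible threshold for the infimum defining
    VaR, also at level 0, where that infimum is -oo. *)
Lemma VaR_le_partial_mean (g : 'cV[R]_m -> R) (t : 'cV[R]_n) (a b : R) :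
    (forall i, t i 0 = g (y i)) -> 0 <= a < b -> b <= 1 ->
  (VaR P (fun w => g (Y w)) a <= (partial_mean p t a b)%:E)%E.
Proof.
move=> tE ab b_le1; have [_ _ _ Pp p_sum1] := HY.
apply: ereal_inf_lbound; exists (partial_mean p t a b) => //=.
rewrite (probability_atoms (fun z => g z <= partial_mean p t a b)) lee_fin.
under eq_bigl do rewrite -tE.
by apply: le_mass_partial_mean => // i; have [] := Pp i.
Qed.

End DiscreteVaR.

Theorem corollary3 (R : realType) (k m n l : nat)
  (X : set 'cV[R]_k) (X_neq0 : X !=set0)
  (d : measure_display) (Omega : measurableType d) (P : probability Omega R)
  (Y : Omega -> 'cV[R]_m) (y : 'I_n -> 'cV[R]_m) (p : 'I_n -> R)
  (HY : discrete_random_vector P Y y p)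
  (f : 'cV[R]_k -> 'cV[R]_m -> R)
  (f_linear : forall i : 'I_n, linear_on X (fun x => f x (y i)))
  (A : 'M[R]_(l, k)) (B : 'M[R]_(l, n)) (c : 'cV[R]_l)
  (X_repr : forall (x : 'cV[R]_k) (t : 'cV[R]_n), t = scenarios f y x ->
     (X x <-> lin_constr A B c x t))
  (XT_neq0 : feasible f y A B c !=set0)
  (XT_closed : closed (feasible f y A B c))
  (XT_convex : convex_set (feasible f y A B c))
  (gamma : R) (gamma_level : 0 <= gamma <= 1)
  (gamma' : R) (gamma'_level : 0 <= gamma' <= 1)
  (gamma_lt : gamma < gamma')
  (gamma'_eq : exists2 delta : R, 0 <= delta & gamma' = gamma + delta) :
  (min_value (feasible f y A B c)
     (fun z => VaR P (fun w => f z.1 (Y w)) gamma)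
   <= min_value (feasible f y A B c)
        (fun z => (partial_mean p (scenarios f y z.1) gamma gamma')%:E))%E.
Proof.
apply: le_ereal_inf_tmp => _ [z Sz <-].
have [gamma_ge0 gamma'_le1] : 0 <= gamma /\ gamma' <= 1 by lra.
apply: ge_ereal_inf; exists (VaR P (fun w => f z.1 (Y w)) gamma); first by exists z.
apply: (@VaR_le_partial_mean _ _ _ _ _ _ _ _ _ HY (f z.1)) => //; last by rewrite gamma_ge0.
by move=> i; rewrite mxE.
Qed.
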